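(* Let $\mathbb{T}$ be a time scale that is unbounded above and has bounded graininess, let $t_0\in\mathbb{T}$, and let $A\in\mathbb{R}^{n\times n}$, $B\in\mathbb{R}^{n\times m}$, $C\in\mathbb{R}^{p\times n}$ be constant matrices with $p,m\le n$ and $A$ regressive. The time invariant regressive linear system $$x^{\Delta}(t)=Ax(t)+Bu(t),\quad x(t_0)=x_0,\qquad y(t)=Cx(t),$$ is controllable if and only if $$\mathrm{rank}\begin{bmatrix}zI-A&B\end{bmatrix}=n$$ for every complex scalar $z$.
   Context: A time scale $\mathbb{T}$ is a nonempty closed subset of $\mathbb{R}$, with forward jump operator $\sigma(t)=\inf\{s\in\mathbb{T}:s>t\}$ and graininess $\mu(t)=\sigma(t)-t$; $f^\Delta$ denotes the delta derivative. A function is rd-continuous if it is continuous at right-dense points of $\mathbb{T}$ and has finite left limits at left-dense points. $A$ (or the system) is regressive if $I+\mu(t)A$ is invertible for all $t\in\mathbb{T}$. The system is controllable on $[t_0,t_f]$ ($t_f\in\mathbb{T}$, $t_f>t_0$) if for every initial state $x_0\in\mathbb{R}^n$ and every prescribed final state $x_f\in\mathbb{R}^n$ there exists an rd-continuous input $u(t)$ such that the corresponding solution satisfies $x(t_f)=x_f$. ''Controllable'', with no interval mentioned, means that states can be steered in finite time, i.e. the system is controllable on $[t_0,t_f]$ for some $t_f\in\mathbb{T}$ with $t_f>t_0$. *)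

(* Defs.v *)
From HB Require Import structures.
From mathcomp Require Import all_boot all_order all_algebra.
From mathcomp Require Import all_classical all_reals.
From mathcomp Require Import topology normedtype.
From mathcomp Require Import complex.

Set Implicit Arguments.
Unset Strict Implicit.
Unset Printing Implicit Defensive.

Import Order.TTheory GRing.Theory Num.Theory.
Import numFieldNormedType.Exports.

Local Open Scope classical_set_scope.
Local Open Scope ring_scope.

Definition time_scale (R : realType) (T : set R) : Prop :=
  T !=set0 /\ closed T.

(* In mathcomp-analysis [inf set0 = 0], so [sigma T t] is meaningful only when
   [t] is not the maximum of [T]; this never occurs for [T] unbounded above. *)
Definition sigma (R : realType) (T : set R) (t : R) : R :=
  inf [set s | T s /\ t < s].

Definition mu (R : realType) (T : set R) (t : R) : R := sigma T t - t.

Definition bounded_graininess (R : realType) (T : set R) : Prop :=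
  exists M : R, forall t, T t -> mu T t <= M.

Definition rho (R : realType) (T : set R) (t : R) : R :=
  sup [set s | T s /\ s < t].

Definition right_dense (R : realType) (T : set R) (t : R) : Prop :=
  sigma T t = t.

(* The minimum of [T], if there is one, does not count as left-dense; the
   first conjunct also avoids the default value [sup set0 = 0]. *)
Definition left_dense (R : realType) (T : set R) (t : R) : Prop :=
  (exists s, T s /\ s < t) /\ rho T t = t.

(* Functions on [T] are represented by functions on [R]: the notions below
   only depend on their values at points of [T]. *)
Definition rd_continuous (R : realType) (T : set R) (f : R -> R) : Prop :=
  (forall t, T t -> right_dense T t ->
     f s @[s --> within T (nbhs t)] --> f t) /\
  (forall t, T t -> left_dense T t ->
     exists l : R, f s @[s --> within [set s | T s /\ s < t] (nbhs t)] --> l).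

Definition is_delta_derivative (R : realType) (T : set R) (f : R -> R)
    (t d : R) : Prop :=
  forall e : R, 0 < e -> \forall s \near t, T s ->
    `|f (sigma T t) - f s - d * (sigma T t - s)| <= e * `|sigma T t - s|.

(* Vector-valued functions are treated entrywise. *)
Definition rd_continuousv (R : realType) (T : set R) (m : nat)
    (u : R -> 'cV[R]_m) : Prop :=
  forall i, rd_continuous T (fun t => u t i 0).

Definition is_delta_derivativev (R : realType) (T : set R) (n : nat)
    (x : R -> 'cV[R]_n) (t : R) (d : 'cV[R]_n) : Prop :=
  forall i, is_delta_derivative T (fun s => x s i 0) t (d i 0).

Definition regressive (R : realType) (T : set R) (n : nat) (A : 'M[R]_n) :
    Prop :=
  forall t, T t -> (1%:M + mu T t *: A) \in unitmx.

(* State [x] and output [y] of the system with input [u]. The equation is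
   imposed on all of [T], on which a regressive system has a unique solution
   for every rd-continuous input. *)
Definition is_solution (R : realType) (T : set R) (n m p : nat)
    (A : 'M[R]_n) (B : 'M[R]_(n, m)) (C : 'M[R]_(p, n))
    (t0 : R) (x0 : 'cV[R]_n) (u : R -> 'cV[R]_m)
    (x : R -> 'cV[R]_n) (y : R -> 'cV[R]_p) : Prop :=
  [/\ x t0 = x0,
      forall t, T t -> is_delta_derivativev T x t (A *m x t + B *m u t)
    & forall t, T t -> y t = C *m x t].

Definition controllable_on (R : realType) (T : set R) (n m p : nat)
    (A : 'M[R]_n) (B : 'M[R]_(n, m)) (C : 'M[R]_(p, n)) (t0 tf : R) : Prop :=
  forall x0 xf : 'cV[R]_n, exists u : R -> 'cV[R]_m,
    rd_continuousv T u /\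
    exists (x : R -> 'cV[R]_n) (y : R -> 'cV[R]_p),
      is_solution T A B C t0 x0 u x y /\ x tf = xf.

Definition controllable (R : realType) (T : set R) (n m p : nat)
    (A : 'M[R]_n) (B : 'M[R]_(n, m)) (C : 'M[R]_(p, n)) (t0 : R) : Prop :=
  exists tf : R, [/\ T tf, t0 < tf & controllable_on T A B C t0 tf].

Definition complexify (R : realType) (n m : nat) (M : 'M[R]_(n, m)) :
    'M[R[i]]_(n, m) :=
  map_mx (real_complex R) M.

(* Main.v *)
(* If the rank drops at [z], a complex left eigenvector [v] of [A] with
   [v *m B = 0] gives a real linear function [K *m x] of the state that solves
   a homogeneous equation whatever the input, so it cannot leave [0].

   Conversely the rank condition yields the Kalman condition in the form
   [\sum_(k < n) A ^+ k *m B *m K k = 1%:M], an identity which turns every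
   [n + 1] times delta differentiable curve [xi] into a trajectory: with
   [g = xi^Delta - A *m xi], put
     [x = xi + \sum_k \sum_(j < k) A ^+ (k - j.+1) *m B *m K k *m g^(Delta^j)]
     [u = \sum_k K k *m g^(Delta^k)].
   Choosing the derivatives of [xi] at both endpoints so that [g] vanishes there
   to order [n] reduces controllability to scalar Hermite interpolation on [T],
   that is, to controllability of a chain of integrators; the latter follows
   from the positivity of a Gramian as soon as [sigma^n(t0) < tf]. No matrix
   exponential is needed, only antiderivatives, obtained as Lebesgue integrals
   of functions frozen on the gaps of [T]. *)
Require Import Defs.
From HB Require Import structures.
From mathcomp Require Import all_boot all_order all_algebra.
From mathcomp Require Import all_classical all_reals.
From mathcomp Require Import topology normedtype sequences.
From mathcomp Require Import measure lebesgue_measure lebesgue_integral.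
From mathcomp Require Import measurable_realfun derive exp.
From mathcomp Require Import complex spectral.
From mathcomp Require Import ring lra.

Set Implicit Arguments.
Unset Strict Implicit.
Unset Printing Implicit Defensive.

Import Order.TTheory GRing.Theory Num.Theory.
Import numFieldNormedType.Exports.

Local Open Scope classical_set_scope.
Local Open Scope ring_scope.

(** * Antiderivatives on the real line *)

(** The signed Lebesgue integral of [G] from 0 works: integrating [|G - d| <= e] gives the estimate.
    Asking for that bound only on a half-open interval allows [e = 0] across a gap of [T], on which
    a frozen function is constant. *)
Lemma primitive_exists (R : realType) (G : R -> R) :
  measurable_fun setT G ->
  (forall N : R, exists K : R, forall r, `|r| <= N -> `|G r| <= K) ->
  exists F : R -> R, forall a b d e : R, a <= b ->
    (forall r, a <= r < b -> `|G r - d| <= e) ->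
    `|F b - F a - d * (b - a)| <= e * (b - a).
Proof.
move=> mG bG.
have intc (f : R -> R) (a b : R) : measurable_fun setT f ->
    (forall N : R, exists K : R, forall r, `|r| <= N -> `|f r| <= K) ->
    (@lebesgue_measure R).-integrable `[a, b]%classic (EFin \o f).
  move=> mf bf; apply: measurable_bounded_integrable => //.
  - by rewrite /= lebesgue_measure_itv /=; case: ifP => _; rewrite ?ltry.
  - exact: measurable_funTS.
  have [K HK] := bf (`|a| + `|b|).
  exists K; split; first by rewrite num_real.
  move=> x Kx r /=; rewrite in_itv /= => /andP[ar rb].
  apply: le_trans (ltW Kx); apply: HK.
  rewrite ler_norml; have := ler_norm b; have := ler_norm (- a).
  by rewrite normrN => *; have ? := normr_ge0 a; have ? := normr_ge0 b;
     apply/andP; split; lra.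
have iG (a b : R) b1 b2 : (@lebesgue_measure R).-integrable
    [set` Interval (BSide b1 a) (BSide b2 b)] (EFin \o G).
  apply: (@integrableS _ _ _ (@lebesgue_measure R) `[a, b]%classic) => //;
    last exact: intc.
  by apply: subset_itv; rewrite bnd_simp; [case: b1|case: b2].
(* [I a b] is 0 when [b <= a], so [I 0 x - I x 0] is the signed integral from 0 to [x]. *)
pose I (a b : R) := \int[lebesgue_measure]_(r in `]a, b]%classic) G r.
have I0 (a b : R) : b <= a -> I a b = 0.
  by move=> ba; rewrite /I set_itv_ge ?Rintegral_set0 // bnd_simp -leNgt.
have IB (a b c : R) : a <= c -> c <= b -> I a b - I a c = I c b.
  by move=> ac cb; rewrite /I Rintegral_itvB ?bnd_simp.
have diff (a b : R) : a <= b -> (I 0 b - I b 0) - (I 0 a - I a 0) = I a b.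
  move=> ab; have [a0|a0] := leP 0 a.
    by rewrite (I0 b) ?(I0 a 0) ?(le_trans a0) // !subr0 IB.
  have {}a0 := ltW a0; have [b0|/ltW b0] := leP 0 b.
    by rewrite (I0 b) // (I0 0 a) // subr0 sub0r opprK -(IB a b 0) // subrK.
  by rewrite (I0 0 b) // (I0 0 a) // !sub0r opprK -(IB a 0 b) // opprB subrK.
exists (fun x => I 0 x - I x 0) => a b d e ab He.
rewrite diff // /I Rintegral_itv_obnd_cbnd // -Rintegral_itv_bndo_bndc //.
have bcst (c : R) (N : R) : exists K, forall r : R, `|r| <= N -> `|c| <= K.
  by exists `|c|.
have ic (c : R) : (@lebesgue_measure R).-integrable `[a, b[%classic
    (EFin \o (fun=> c)).
  apply: (@integrableS _ _ _ (@lebesgue_measure R) `[a, b]%classic) => //;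
    last exact: intc.
  by apply: subset_itv; rewrite bnd_simp.
have vol (c : R) : \int[lebesgue_measure]_(r in `[a, b[%classic) c = c * (b - a).
  rewrite Rintegral_cst //= lebesgue_measure_itv /= lte_fin.
  case: ltP => //= ba; have -> : a = b by apply/le_anti/andP.
  by rewrite subrr.
rewrite -(vol d) -RintegralB // -(vol e).
have iGd : (@lebesgue_measure R).-integrable `[a, b[%classic
    (EFin \o (fun r => G r - d)).
  rewrite (_ : _ \o _ = (EFin \o G) \- (EFin \o (fun=> d)))%E.
    exact: integrableB.
  by apply/funext => r /=; rewrite EFinB.
apply: le_trans (le_normr_Rintegral _ _) _ => //.
apply: le_Rintegral => //.
exact: (@integrable_norm _ _ _ (@lebesgue_measure R)).
Qed.

(** * Time scales *)

Lemma nbhs_distP (R : realType) (t : R) (P : set R) :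
  nbhs t P <-> exists2 del : R, 0 < del & forall s, `|t - s| < del -> P s.
Proof.
split=> [/nbhs_ballP[del /= del0 H]|[del del0 H]].
  by exists del.
by apply/nbhs_ballP; exists del.
Qed.

Lemma continuous_sumr (R : realType) (I : Type) (r : seq I) (P : pred I)
    (F : I -> R -> R) :
  (forall i, P i -> continuous (F i)) ->
  continuous (fun x => \sum_(i <- r | P i) F i x).
Proof.
move=> cF; apply: continuous_big => //; exact: add_continuous.
Qed.

Section TimeScale.
Context (R : realType) (T : set R) (hT : closed T) (hunb : ~ has_ubound T).
Implicit Types (s t : R) (f g : R -> R).

Lemma time_scale_above t : exists2 s, T s & t < s.
Proof.
apply: contrapT => H; apply: hunb; exists t => s Ts.
by rewrite leNgt; apply/negP => ts; apply: H; exists s.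
Qed.

Lemma time_scale_closure t :
  (forall del : R, 0 < del -> exists2 s, T s & `|t - s| < del) -> T t.
Proof.
move=> H; apply: hT => B /nbhs_distP[del del0 HB].
by have [s Ts ts] := H _ del0; exists s; split=> //; exact: HB.
Qed.

Lemma sigma_has_inf t : has_inf [set s | T s /\ t < s].
Proof.
split; first by have [s Ts ts] := time_scale_above t; exists s.
by exists t => s [_ /ltW].
Qed.

Lemma sigma_ge t : t <= sigma T t.
Proof. by apply: lb_le_inf => [|s [_ /ltW //]]; case: (sigma_has_inf t). Qed.

Lemma sigma_le t s : T s -> t < s -> sigma T t <= s.
Proof. by move=> Ts ts; apply: ge_inf => //; case: (sigma_has_inf t). Qed.

Lemma sigma_adherent t c : sigma T t < c -> exists s, [/\ T s, t < s & s < c].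
Proof.
rewrite -subr_gt0 => /(inf_adherent)/(_ (sigma_has_inf t))[s [Ts ts]].
by rewrite -/(sigma T t) addrC subrK => sc; exists s.
Qed.

Lemma sigma_in t : T (sigma T t).
Proof.
apply: time_scale_closure => del del0.
have [|s [Ts ts sc]] := @sigma_adherent t (sigma T t + del).
  by rewrite ltrDl.
exists s => //; have ss := sigma_le Ts ts.
by rewrite ler0_norm ?subr_le0 //; lra.
Qed.

Lemma sigma_nondecreasing : {homo sigma T : s t / s <= t}.
Proof.
move=> s t st; rewrite leNgt; apply/negP => /sigma_adherent[r [Tr tr]].
by rewrite ltNge sigma_le // (le_lt_trans st).
Qed.

Lemma sigma_prec t s : T s -> s < sigma T t -> s <= t.
Proof.
move=> Ts; rewrite ltNge => /negP ts; rewrite leNgt; apply/negP => /(sigma_le Ts).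
exact: ts.
Qed.

(* Real induction adapted to [T]; the second, third and fourth hypotheses
   cross right-scattered, right-dense and left-dense points. *)
Lemma time_scale_ind a (P : R -> Prop) : T a -> P a ->
  (forall t, T t -> a <= t -> t < sigma T t -> P t -> P (sigma T t)) ->
  (forall t, T t -> a <= t -> sigma T t = t -> P t ->
     exists2 del : R, 0 < del & forall s, T s -> t < s < t + del -> P s) ->
  (forall t, T t -> a < t ->
     (forall del : R, 0 < del -> exists s, [/\ T s, a <= s & t - del < s < t]) ->
     (forall s, T s -> a <= s -> s < t -> P s) -> P t) ->
  forall t, T t -> a <= t -> P t.
Proof.
move=> Ta Pa Hs Hr Hl b Tb ab.
(* [E] collects the points up to which [P] holds throughout from [a] on. Its supremum [c] lies in
   [T] and satisfies [P]; if [c < b], then [E] would extend past [c], against [ext]. *)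
pose E := [set t | [/\ T t, a <= t, t <= b &
                       forall s, T s -> a <= s -> s <= t -> P s]].
have Ea : E a.
  split=> // s Ts as_ sa; suff -> : s = a by [].
  by apply/le_anti/andP.
have supE : has_sup E by split; [exists a | exists b => t []].
pose c := sup E.
have ac : a <= c := sup_upper_bound supE Ea.
have cb : c <= b by apply: ge_sup; [exists a|move=> t []].
have adh del : 0 < del -> exists2 t, E t & c - del < t.
  by move=> del0; exact: sup_adherent.
have Pltc s : T s -> a <= s -> s < c -> P s.
  move=> Ts as_ sc; have [|t [_ _ _ Pt]] := adh (c - s); first by rewrite subr_gt0.
  by rewrite opprB addrC subrK => st; apply: Pt => //; exact: ltW.
have Tc : T c.
  apply: time_scale_closure => del del0; have [t Et ct] := adh _ del0.
  have tc : t <= c := sup_upper_bound supE Et.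
  exists t; first by case: Et.
  by rewrite ger0_norm ?subr_ge0 //; lra.
have Pc : P c.
  have [Ec|nEc] := pselect (E c); first by case: Ec => _ _ _; exact.
  move: ac; rewrite le_eqVlt => /predU1P[ac|ac]; first by rewrite -ac.
  apply: Hl => // del del0; have [t Et ct] := adh _ del0.
  exists t; case: (Et) => Tt at_ _ _; split=> //; rewrite ct /=.
  rewrite lt_neqAle (sup_upper_bound supE Et) andbT.
  by apply/eqP => tc; apply: nEc; rewrite -tc.
have ext d : T d -> c < d -> d <= b -> ~ (forall s, T s -> c < s -> s <= d -> P s).
  move=> Td cd db Ps; suff /(sup_upper_bound supE) : E d by rewrite leNgt cd.
  split=> //; first exact: le_trans ac (ltW cd).
  move=> s Ts as_ sd; have [sc|sc|->//] := ltgtP s c; first exact: Pltc.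
  exact: Ps.
move: cb; rewrite le_eqVlt => /predU1P[<- //|cb].
have [cs|] := ltP c (sigma T c).
  case: (ext (sigma T c)); [exact: sigma_in|by []|exact: sigma_le|].
  move=> s Ts csl ss; have -> : s = sigma T c.
    by apply/le_anti; rewrite ss sigma_le.
  exact: Hs.
rewrite le_eqVlt ltNge sigma_ge orbF => /eqP sc.
have [del del0 Hdel] := Hr c Tc ac sc Pc.
have [|d [Td cd]] := @sigma_adherent c (Num.min b (c + del)).
  by rewrite sc lt_min cb ltrDl.
rewrite lt_min => /andP[db dd].
case: (ext d) => //; first exact: ltW.
by move=> s Ts csl sd; apply: Hdel => //; rewrite csl (le_lt_trans sd).
Qed.

(** * Delta derivatives *)

(** The point [s = t] lies in every neighborhood of [t], so the error there is below every positive
    bound. *)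
Lemma delta_derivative_sigma f t d : T t -> is_delta_derivative T f t d ->
  f (sigma T t) = f t + d * (sigma T t - t).
Proof.
move=> Tt Hf.
suff H (e : R) : 0 < e -> `|f (sigma T t) - f t - d * (sigma T t - t)| <= e.
  apply/eqP; rewrite -subr_eq0 opprD addrA -normr_eq0 eq_le normr_ge0 andbT.
  by apply/ler_addgt0Pl => e /H; rewrite addr0.
move=> e0; have M0 : 0 < `|sigma T t - t| + 1 by rewrite ltr_pwDr.
have := nbhs_singleton (Hf _ (divr_gt0 e0 M0)) Tt; move/le_trans; apply.
rewrite -mulrA; apply: ler_piMr; first exact: ltW.
by rewrite mulrC ler_pdivrMr // mul1r lerDl.
Qed.

Lemma delta_derivative_continuous f t d : T t -> is_delta_derivative T f t d ->
  forall e : R, 0 < e -> \forall s \near t, T s -> `|f t - f s| < e.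
Proof.
move=> Tt Hf e e0; have fs := delta_derivative_sigma Tt Hf.
(* Once [|t - s| < 1], this quantity bounds [|sigma T t - s|]; dividing [e / 2] by it keeps the
   remainder below [e / 2]. *)
have M0 : 0 < `|sigma T t - t| + 1 by rewrite ltr_pwDr.
have D0 : 0 < `|d| + 1 by rewrite ltr_pwDr.
have e2 : 0 < e / 2 by rewrite divr_gt0.
have He := Hf _ (divr_gt0 e2 M0).
have ts_lt1 : \forall s \near t, `|t - s| < 1 by apply/nbhs_distP; exists 1.
have ts_lt : \forall s \near t, `|t - s| < e / 2 / (`|d| + 1).
  by apply/nbhs_distP; exists (e / 2 / (`|d| + 1)); rewrite ?divr_gt0.
near=> s => Ts.
have H1 : `|f (sigma T t) - f s - d * (sigma T t - s)| <=
    e / 2 / (`|sigma T t - t| + 1) * `|sigma T t - s|.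
  by move: Ts; near: s.
have -> : f t - f s = (f (sigma T t) - f s - d * (sigma T t - s)) + d * (t - s).
  by rewrite fs; ring.
rewrite [ltRHS](splitr e).
apply: le_lt_trans (ler_normD _ _) _; apply: ler_ltD.
  apply: le_trans H1 _; rewrite -mulrA; apply: ler_piMr; first exact: ltW.
  rewrite mulrC ler_pdivrMr // mul1r.
  have -> : sigma T t - s = (sigma T t - t) + (t - s) by ring.
  apply: le_trans (ler_normD _ _) _; rewrite lerD2l ltW //; near: s; exact: ts_lt1.
rewrite normrM; apply: (@le_lt_trans _ _ ((`|d| + 1) * `|t - s|)).
  by rewrite ler_wpM2r // lerDl.
by rewrite mulrC -ltr_pdivlMr //; near: s.
Unshelve. all: by end_near. Qed.

(** Rescaling [e] absorbs a fixed factor [K], so that estimates for sums and products need no tuned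
    tolerances. *)
Lemma delta_derivative_boundP (K : R) f t d : 0 < K ->
  (forall e : R, 0 < e -> \forall s \near t, T s ->
    `|f (sigma T t) - f s - d * (sigma T t - s)| <= K * e * `|sigma T t - s|) ->
  is_delta_derivative T f t d.
Proof.
move=> K0 H e e0; have := H (K^-1 * e); rewrite mulr_gt0 ?invr_gt0 // mulrA.
by rewrite divff ?gt_eqF // mul1r; apply.
Qed.

Lemma delta_derivative_cst c t : is_delta_derivative T (fun=> c) t 0.
Proof.
move=> e e0; near=> s => _.
by rewrite subrr mul0r subrr normr0 mulr_ge0 // ltW.
Unshelve. all: by end_near. Qed.

Lemma delta_derivativeD f g t d1 d2 :
  is_delta_derivative T f t d1 -> is_delta_derivative T g t d2 ->
  is_delta_derivative T (fun s => f s + g s) t (d1 + d2).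
Proof.
move=> Hf Hg; apply: (@delta_derivative_boundP 2) => // e e0.
have Hfe := Hf e e0; have Hge := Hg e e0.
near=> s => Ts.
have H1 : `|f (sigma T t) - f s - d1 * (sigma T t - s)| <= e * `|sigma T t - s|.
  by move: Ts; near: s.
have H2 : `|g (sigma T t) - g s - d2 * (sigma T t - s)| <= e * `|sigma T t - s|.
  by move: Ts; near: s.
have -> : f (sigma T t) + g (sigma T t) - (f s + g s) -
    (d1 + d2) * (sigma T t - s) =
  (f (sigma T t) - f s - d1 * (sigma T t - s)) +
  (g (sigma T t) - g s - d2 * (sigma T t - s)) by ring.
by apply: le_trans (ler_normD _ _) _; lra.
Unshelve. all: by end_near. Qed.

(** With [f] taken at the jump and [g] at [t], the derivatives of products of dual chains
    telescope. *)
Lemma delta_derivativeM f g t d1 d2 : T t ->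
  is_delta_derivative T f t d1 -> is_delta_derivative T g t d2 ->
  is_delta_derivative T (fun s => f s * g s) t (d1 * g t + f (sigma T t) * d2).
Proof.
move=> Tt Hf Hg.
have [G G0 gG] : exists2 G : R, 0 < G & `|g t| + 1 <= G.
  by exists (`|g t| + 1) => //; rewrite ltr_pwDr.
apply: (@delta_derivative_boundP (`|f (sigma T t)| + G + `|d1|)) => [|e e0].
  by rewrite ltr_wpDr // ltr_wpDl.
have Hfe := Hf e e0; have Hge := Hg e e0.
have Hc1 := delta_derivative_continuous Tt Hg ltr01.
have Hce := delta_derivative_continuous Tt Hg e0.
near=> s => Ts.
have H1 : `|f (sigma T t) - f s - d1 * (sigma T t - s)| <= e * `|sigma T t - s|.
  by move: Ts; near: s.
have H2 : `|g (sigma T t) - g s - d2 * (sigma T t - s)| <= e * `|sigma T t - s|.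
  by move: Ts; near: s.
have H3 : `|g t - g s| < 1 by move: Ts; near: s.
have H4 : `|g t - g s| < e by move: Ts; near: s.
have gs : `|g s| <= G.
  have -> : g s = g t - (g t - g s) by ring.
  by apply: le_trans (ler_normB _ _) (le_trans _ gG); rewrite lerD2l ltW.
set m : R := `|sigma T t - s|.
have -> : f (sigma T t) * g (sigma T t) - f s * g s -
    (d1 * g t + f (sigma T t) * d2) * (sigma T t - s) =
  f (sigma T t) * (g (sigma T t) - g s - d2 * (sigma T t - s)) +
  (f (sigma T t) - f s - d1 * (sigma T t - s)) * g s -
  d1 * (g t - g s) * (sigma T t - s) by ring.
apply: le_trans (ler_normB _ _) _; 
have -> : (`|f (sigma T t)| + G + `|d1|) * e * m =
  `|f (sigma T t)| * e * m + G * e * m + `|d1| * e * m by ring.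
apply: lerD; last first.
  by rewrite !normrM -!mulrA ler_wpM2l // ler_wpM2r // ltW.
apply: le_trans (ler_normD _ _) _; apply: lerD.
  by rewrite normrM -mulrA ler_wpM2l.
by rewrite normrM mulrC -mulrA; apply: ler_pM.
Unshelve. all: by end_near. Qed.

Lemma delta_derivativeZ c f t d : T t -> is_delta_derivative T f t d ->
  is_delta_derivative T (fun s => c * f s) t (c * d).
Proof.
move=> Tt Hf; rewrite -[c * d]add0r -(mul0r (f t)).
exact: delta_derivativeM (delta_derivative_cst _ _) Hf.
Qed.

Lemma delta_derivative_sum (I : Type) (r : seq I) (P : pred I)
    (F : I -> R -> R) (D : I -> R) t :
  (forall i, P i -> is_delta_derivative T (F i) t (D i)) ->
  is_delta_derivative T (fun s => \sum_(i <- r | P i) F i s) t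
    (\sum_(i <- r | P i) D i).
Proof.
move=> H; elim: r => [|i r IH].
  rewrite big_nil; rewrite (_ : (fun _ => _) = fun=> 0).
    exact: delta_derivative_cst.
  by apply/funext => s; rewrite big_nil.
rewrite big_cons (_ : (fun _ => _) = fun s => if P i then F i s +
  \sum_(j <- r | P j) F j s else \sum_(j <- r | P j) F j s); last first.
  by apply/funext => s; rewrite big_cons.
by case: ifPn => // Pi; apply: delta_derivativeD => //; exact: H.
Qed.

(** * Vanishing, monotonicity and uniqueness from delta derivatives *)

(** At a right-scattered [s], both [f s] and [f (sigma T s)] are 0, and the graininess divides out.
    At a right-dense [s], zeros of [f] just to the right of [s] force [|d| <= e] for every [e]. *)
Lemma delta_derivative_eq0 f s b d : T b -> s < b ->
  (forall r, T r -> s <= r -> r <= b -> f r = 0) ->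
  T s -> is_delta_derivative T f s d -> d = 0.
Proof.
move=> Tb sb f0 Ts Hf.
have fs0 : f (sigma T s) = 0.
  by apply: f0; [exact: sigma_in|exact: sigma_ge|exact: sigma_le].
have [ss|] := ltP s (sigma T s).
  have := delta_derivative_sigma Ts Hf; rewrite fs0 (f0 s Ts (lexx s) (ltW sb)) add0r.
  by move/esym/eqP; rewrite mulf_eq0 subr_eq0 (gt_eqF ss) orbF => /eqP.
rewrite le_eqVlt ltNge sigma_ge orbF => /eqP se.
apply/eqP; rewrite -normr_eq0 eq_le normr_ge0 andbT.
apply/ler_addgt0Pl => e e0; rewrite addr0.
have [del del0 /= H] := (nbhs_distP _ _).1 (Hf e e0).
have [|r [Tr sr]] := @sigma_adherent s (Num.min b (s + del)).
  by rewrite se lt_min sb ltrDl.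
rewrite lt_min => /andP[rb rd].
have rs0 : 0 < `|s - r| by rewrite normr_gt0 subr_eq0 lt_eqF.
have := H r; rewrite se (f0 s Ts (lexx s) (ltW sb)) (f0 r Tr (ltW sr) (ltW rb)).
rewrite subrr sub0r normrN normrM ler_pM2r //; apply => //.
by rewrite ltr0_norm ?subr_lt0 //; lra.
Qed.

(** Induction on [T] proves [f a - e * (t - a) <= f t], and then [e] tends to 0. The slack [e] pays
    for the derivative error at right-dense points. *)
Lemma delta_derivative_nondecreasing f (d : R -> R) a b :
  T a -> T b -> a <= b ->
  (forall t, T t -> is_delta_derivative T f t (d t)) ->
  (forall t, T t -> 0 <= d t) -> f a <= f b.
Proof.
move=> Ta Tb ab Hf d0.
suff H (e : R) : 0 < e -> f a - e * (b - a) <= f b.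
  apply/ler_addgt0Pl => e e0; have M0 : 0 < b - a + 1 by lra.
  have := H _ (divr_gt0 e0 M0); rewrite lerBlDl => /le_trans; apply.
  rewrite lerD2r -mulrA; apply: ler_piMr; first exact: ltW.
  by rewrite mulrC ler_pdivrMr // mul1r; lra.
move=> e0; apply: (@time_scale_ind a (fun t => f a - e * (t - a) <= f t)) Tb ab => //.
- by rewrite subrr mulr0 subr0.
- move=> t Tt at_ ts; rewrite (delta_derivative_sigma Tt (Hf t Tt)).
  have := d0 t Tt => dt0 IH; apply: le_trans (_ : f t <= _); last first.
    by rewrite lerDl mulr_ge0 // subr_ge0 ltW.
  by apply: le_trans _ IH; rewrite lerD2l lerN2 ler_pM2l // lerD2r ltW.
- move=> t Tt at_ ts IH; have [del del0 /= H] := (nbhs_distP _ _).1 (Hf t Tt e e0).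
  exists del => // s Ts /andP[ts1 ts2].
  have ts_lt : `|t - s| < del by rewrite ltr0_norm ?subr_lt0 //; lra.
  have := H s ts_lt Ts.
  rewrite ts [`|t - s|]ltr0_norm ?subr_lt0 // ler_norml => /andP[_].
  have : 0 <= d t * (s - t) by rewrite mulr_ge0 ?subr_ge0 ?d0 ?ltW.
  by move: IH; rewrite !mulrBr mulrN; lra.
- move=> t Tt at_ Hl IH; apply/ler_addgt0Pl => e1 e10.
  have [del del0 /= H] :=
    (nbhs_distP _ _).1 (delta_derivative_continuous Tt (Hf t Tt) e10).
  have [s [Ts as_ /andP[s1 s2]]] := Hl _ del0.
  have ts_lt : `|t - s| < del by rewrite gtr0_norm ?subr_gt0 //; lra.
  have := H s ts_lt Ts; rewrite ltr_norml => /andP[H1 _]; have := IH s Ts as_ s2.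
  have : e * s <= e * t by rewrite ler_pM2l // ltW.
  by rewrite !mulrBr; lra.
Qed.

(** A comparison with an ordinary exponential: every entry of [w] stays below [e * E t], with [e]
    arbitrary. The rate is [L + 1], where [L] dominates the action of [M] and the extra 1 absorbs
    the derivative error at right-dense points. Since [1 + x <= expR x], jumps and dense steps are
    handled alike. *)
Lemma linear_delta_unique (k : nat) (M : 'M[R]_k) (w : R -> 'cV[R]_k) a b :
  T a -> T b -> a <= b ->
  (forall t, T t -> is_delta_derivativev T w t (M *m w t)) ->
  w a = 0 -> w b = 0.
Proof.
move=> Ta Tb ab Hw wa0.
pose L : R := \sum_i \sum_j `|M i j|.
have L0 : 0 <= L by do 2!apply: sumr_ge0 => ? _.
pose E t := expR ((L + 1) * (t - a)).
have Ege t s : E t * (1 + (L + 1) * (s - t)) <= E s.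
  rewrite /E; have -> : (L + 1) * (s - a) = (L + 1) * (t - a) + (L + 1) * (s - t).
    by ring.
  by rewrite expRD ler_pM2l ?expR_gt0 // expR_ge1Dx.
have E0 t : 0 < E t by exact: expR_gt0.
have Emono t s : t <= s -> E t <= E s.
  by move=> ts; rewrite ler_expR ler_wpM2l ?lerD2r // addr_ge0.
have Hder (e : R) t i : (forall j, `|w t j 0| <= e * E t) ->
    `|(M *m w t) i 0| <= L * (e * E t).
  move=> H; have eE0 : 0 <= e * E t by exact: le_trans (normr_ge0 _) (H i).
  rewrite mxE; apply: le_trans (ler_norm_sum _ _ _) _.
  apply: le_trans (_ : (\sum_j `|M i j|) * (e * E t) <= _).
    by rewrite mulr_suml; apply: ler_sum => j _; rewrite normrM ler_wpM2l.
  rewrite ler_wpM2r // /L [leRHS](bigD1 i) //= lerDl.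
  by apply: sumr_ge0 => ? _; exact: sumr_ge0.
suff H (e : R) i : 0 < e -> `|w b i 0| <= e * E b.
  apply/colP => i; rewrite mxE; apply/eqP; rewrite -normr_eq0 eq_le normr_ge0 andbT.
  apply/ler_addgt0Pl => e e0; rewrite addr0.
  by have := H _ i (divr_gt0 e0 (E0 b)); rewrite divfK ?gt_eqF.
move=> e0; move: i.
apply: (@time_scale_ind a (fun t => forall i, `|w t i 0| <= e * E t)) Tb ab => //.
- by move=> i; rewrite wa0 mxE normr0 mulr_ge0 ?ltW.
- move=> t Tt at_ ts IH i; rewrite (delta_derivative_sigma Tt (Hw t Tt i)).
  apply: le_trans (ler_normD _ _) _; rewrite normrM.
  have m0 : 0 < sigma T t - t by rewrite subr_gt0.
  rewrite (gtr0_norm m0).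
  apply: le_trans (_ : e * (E t * (1 + (L + 1) * (sigma T t - t))) <= _); last first.
    by rewrite ler_pM2l.
  have Hd := Hder e t i IH; have := IH i.
  have : `|(M *m w t) i 0| * (sigma T t - t) <= L * (e * E t) * (sigma T t - t).
    by rewrite ler_pM2r.
  have : 0 <= e * E t * (sigma T t - t) by rewrite !mulr_ge0 ?ltW.
  by rewrite !(mulrDr, mulrDl, mul1r, mulr1); lra.
- move=> t Tt at_ ts IH; have eE : 0 < e * E t by exact: mulr_gt0.
  have : \forall s \near t, forall i, T s -> `|w (sigma T t) i 0 - w s i 0 -
      (M *m w t) i 0 * (sigma T t - s)| <= (e * E t) * `|sigma T t - s|.
    exact: (@filter_forall _ _ _ _ (nbhs_filter t) (fun i => Hw t Tt i _ eE)).
  move=> /nbhs_distP[del del0 H]; exists del => // s Ts /andP[ts1 ts2] i.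
  have ts_lt : `|t - s| < del by rewrite ltr0_norm ?subr_lt0 //; lra.
  have := H s ts_lt i Ts; rewrite ts [`|t - s|]ltr0_norm ?subr_lt0 // opprB.
  set D := (M *m w t) i 0 => H1.
  have -> : w s i 0 = w t i 0 - (w t i 0 - w s i 0 - D * (t - s)) + D * (s - t).
    by ring.
  apply: le_trans (ler_normD _ _) _.
  apply: le_trans (lerD (ler_normB _ _) (lexx _)) _.
  apply: le_trans (_ : e * (E t * (1 + (L + 1) * (s - t))) <= _); last first.
    by rewrite ler_pM2l.
  have m0 : 0 < s - t by rewrite subr_gt0.
  have H2 : `|D * (s - t)| <= L * (e * E t) * (s - t).
    by rewrite normrM (gtr0_norm m0) ler_pM2r // Hder.
  have H3 := IH i.
  have -> : e * (E t * (1 + (L + 1) * (s - t))) = e * E t + e * E t * (s - t) +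
    L * (e * E t) * (s - t) by ring.
  by apply: lerD => //; apply: lerD.
- move=> t Tt at_ Hl IH i; apply/ler_addgt0Pl => e1 e10.
  have [del del0 /= H] :=
    (nbhs_distP _ _).1 (delta_derivative_continuous Tt (Hw t Tt i) e10).
  have [s [Ts as_ /andP[s1 s2]]] := Hl _ del0.
  have ts_lt : `|t - s| < del by rewrite gtr0_norm ?subr_gt0 //; lra.
  have -> : w t i 0 = (w t i 0 - w s i 0) + w s i 0 by rewrite subrK.
  apply: le_trans (ler_normD _ _) _; apply: lerD; first exact/ltW/H.
  by apply: le_trans (IH s Ts as_ s2 i) _; rewrite ler_pM2l // Emono // ltW.
Qed.

(** * Delta antiderivatives *)

(* Lower bounds of [T] are added so that the supremum is never that of an empty
   set, which keeps this function nondecreasing on the whole line. *)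
Definition time_scale_floor (r : R) : R :=
  sup [set s | (T s \/ lbound T s) /\ s <= r].

Lemma time_scale_floor_has_sup r :
  has_sup [set s | (T s \/ lbound T s) /\ s <= r].
Proof.
split; last by exists r => s [].
have [[s Ts sr]|H] := pselect (exists2 s, T s & s <= r).
  by exists s; split=> //; left.
exists r; split=> //; right=> s Ts; rewrite leNgt; apply/negP => sr.
by apply: H; exists s => //; exact: ltW.
Qed.

Lemma time_scale_floor_le r : time_scale_floor r <= r.
Proof.
by apply: ge_sup => [|s []//]; case: (time_scale_floor_has_sup r).
Qed.

Lemma time_scale_floor_ge r s : T s -> s <= r -> s <= time_scale_floor r.
Proof.
move=> Ts sr; apply: (sup_upper_bound (time_scale_floor_has_sup r)).
by split=> //; left.
Qed.

Lemma time_scale_floor_nondecreasing :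
  {homo time_scale_floor : r s / r <= s}.
Proof.
move=> r s rs; apply: ge_sup => [|x [Tx xr]].
  by case: (time_scale_floor_has_sup r).
apply: (sup_upper_bound (time_scale_floor_has_sup s)).
by split=> //; exact: le_trans xr rs.
Qed.

Lemma time_scale_floor_in r s : T s -> s <= r -> T (time_scale_floor r).
Proof.
move=> Ts sr; have := time_scale_floor_ge Ts sr; rewrite le_eqVlt.
move=> /predU1P[<- //|sf]; apply: time_scale_closure => del del0.
(* The second bound places the approximating point above [s], so it cannot be a lower bound of [T]
   and must lie in [T]. *)
have m0 : 0 < Num.min del (time_scale_floor r - s).
  by rewrite lt_min del0 subr_gt0.
have [x Hx] := sup_adherent m0 (time_scale_floor_has_sup r).
rewrite -/(time_scale_floor r) => fx.
have xf := sup_upper_bound (time_scale_floor_has_sup r) Hx.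
rewrite -/(time_scale_floor r) in xf.
have [mdel ms] : Num.min del (time_scale_floor r - s) <= del /\
    Num.min del (time_scale_floor r - s) <= time_scale_floor r - s.
  by rewrite !ge_min !lexx orbT.
case: Hx => -[Tx|lx] xr; last by have := lx s Ts; lra.
by exists x => //; rewrite ger0_norm ?subr_ge0 //; lra.
Qed.

Lemma time_scale_floor_eq t r :
  T t -> t <= r -> r < sigma T t -> time_scale_floor r = t.
Proof.
move=> Tt tr rs; apply/le_anti; rewrite (time_scale_floor_ge Tt tr) andbT.
apply: sigma_prec; first exact: time_scale_floor_in Tt tr.
exact: le_lt_trans (time_scale_floor_le r) rs.
Qed.

(** [F] is a real primitive of [f] composed with [k] and the floor of [T]; monotonicity makes this
    integrand measurable and locally bounded. Taking [k] to be the identity or [sigma T] integrates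
    [f] or its shift by [sigma T]. *)
Lemma antiderivative_exists f (k : R -> R) a :
  continuous f -> {homo k : s t / s <= t} ->
  (forall t, T t -> right_dense T t -> forall e : R, 0 < e ->
     \forall s \near t, T s -> `|k t - k s| < e) ->
  exists F : R -> R, [/\ continuous F, F a = 0 &
    forall t, T t -> is_delta_derivative T F t (f (k t))].
Proof.
move=> cf kmono kcont.
pose kf r := k (time_scale_floor r).
have kf_mono : {homo kf : r s / r <= s}.
  by move=> r s /time_scale_floor_nondecreasing /kmono.
pose G r := f (kf r).
have bG N : exists K : R, forall r, `|r| <= N -> `|G r| <= K.
  have [N0|N0] := ltP N 0.
    exists 0 => r rN; have := le_lt_trans rN N0.
    by rewrite ltNge normr_ge0.
  have [||c _ Hc] := @EVT_max R (fun x => `|f x|) (kf (- N)) (kf N).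
  - by apply: kf_mono; lra.
  - apply: continuous_subspaceT => x.
    by apply: continuous_comp; [exact: cf|exact: norm_continuous].
  exists `|f c| => r; rewrite ler_norml => /andP[Nr rN]; apply: Hc.
  by rewrite in_itv /= !kf_mono.
have [|F0 HF] := primitive_exists _ bG.
  apply: measurableT_comp; first exact: continuous_measurable_fun.
  exact: nondecreasing_measurable.
have cF0 : continuous F0.
  move=> x; have [K HK] := bG (`|x| + 1).
  have K0 : 0 <= K by apply: le_trans (HK 0 _); rewrite ?normr0 ?addr_ge0.
  apply/cvgrPdist_lt => e e0; apply/nbhs_distP.
  exists (Num.min 1 (e / (K + 1))).
    by rewrite lt_min ltr01 divr_gt0 // ltr_wpDl.
  move=> y; rewrite lt_min => /andP[xy1 xye].
  suff: `|F0 x - F0 y| <= K * `|x - y|.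
    move=> /le_lt_trans; apply; move: xye; rewrite ltr_pdivlMr ?ltr_wpDl //.
    rewrite mulrDr mulr1 mulrC => /(le_lt_trans _); apply.
    by rewrite lerDl.
  have [xn xp] : - `|x| <= x /\ x <= `|x|.
    by split; [rewrite lerNl -normrN ler_norm|exact: ler_norm].
  move: xy1; rewrite ltr_norml => /andP[xy1 xy2].
  have [xy|/ltW yx] := leP x y.
    have := HF x y 0 K xy; rewrite mul0r subr0 distrC (distrC x).
    rewrite [`|y - x|]ger0_norm ?subr_ge0 //.
    apply=> r /andP[xr ry]; rewrite subr0; apply: HK; rewrite ler_norml.
    by apply/andP; split; lra.
  have := HF y x 0 K yx; rewrite mul0r subr0 [`|x - y|]ger0_norm ?subr_ge0 //.
  apply=> r /andP[xr ry]; rewrite subr0; apply: HK; rewrite ler_norml.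
  by apply/andP; split; lra.
exists (fun x => F0 x - F0 a); split; [|by rewrite subrr|].
  by move=> x; apply: cvgB; [exact: cF0|exact: cvg_cst].
move=> t Tt e e0.
have shift x y : F0 x - F0 a - (F0 y - F0 a) = F0 x - F0 y by ring.
have [ts|] := ltP t (sigma T t); last first.
  rewrite le_eqVlt ltNge sigma_ge orbF => /eqP ts.
  have [del1 del10 H1] : exists2 del : R, 0 < del & forall y, `|k t - y| < del ->
      `|f (k t) - f y| < e.
    by have /cvgrPdist_lt/(_ e e0)/nbhs_distP := cf (k t).
  have [del del0 H] := (nbhs_distP _ _).1 (kcont t Tt ts _ del10).
  apply/nbhs_distP; exists del => // s std Ts; rewrite ts shift.
  (* At a right-dense [t], the integrand between [s] and [t] only takes values [f (k r)] with [r] in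
     [T] between them, all close to [f (k t)]. *)
  have near r : T r -> `|t - r| < del -> `|f (k r) - f (k t)| <= e.
    by move=> Tr tr; rewrite distrC; apply/ltW/H1/H.
  move: (std); rewrite ltr_norml => /andP[std1 std2].
  have [st|/ltW ts'] := leP s t.
    rewrite [leRHS](_ : _ = e * (t - s)); last by rewrite ger0_norm ?subr_ge0.
    apply: HF => // r /andP[sr rt]; apply: near.
      exact: time_scale_floor_in Ts sr.
    have := time_scale_floor_le r; have := time_scale_floor_ge Ts sr => *.
    by rewrite ger0_norm ?subr_ge0; lra.
  rewrite (_ : _ - _ = - (F0 s - F0 t - f (k t) * (s - t))); last by ring.
  rewrite normrN (distrC t s) (ger0_norm (x := s - t)) ?subr_ge0 //.
  apply: HF => // r /andP[tr rs]; apply: near.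
    exact: time_scale_floor_in Tt tr.
  have := time_scale_floor_le r; have := time_scale_floor_ge Tt tr => *.
  by rewrite ler0_norm ?subr_le0; lra.
have Fs : F0 (sigma T t) - F0 t = f (k t) * (sigma T t - t).
  apply/eqP; rewrite -subr_eq0 -normr_eq0 eq_le normr_ge0 andbT.
  have := HF t (sigma T t) (f (k t)) 0 (ltW ts); rewrite mul0r; apply.
  move=> r /andP[tr rs]; rewrite /G /kf (time_scale_floor_eq Tt tr rs).
  by rewrite subrr normr0.
have [K HK] := bG (`|t| + 1).
have K0 : 0 <= K by apply: le_trans (HK 0 _); rewrite ?normr0 ?addr_ge0.
pose K' := K + `|f (k t)| + 1.
have K'0 : 0 < K' by rewrite /K' ltr_wpDl // addr_ge0.
have m0 : 0 < sigma T t - t by rewrite subr_gt0.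
(* The first bound keeps [s] below [sigma T t], hence [s <= t]. The last makes the error
   [K' * (t - s)] at most [e] times the graininess, which the tolerance always exceeds or equals. *)
apply/nbhs_distP.
exists (Num.min (sigma T t - t) (Num.min 1 (e * (sigma T t - t) / K'))).
  by rewrite !lt_min m0 ltr01 divr_gt0 // mulr_gt0.
move=> s; rewrite !lt_min => /and3P[std1 std2 std3] Ts; rewrite shift.
have st : s <= t.
  apply: sigma_prec => //; move: std1; rewrite ltr_norml => /andP[? _]; lra.
have s0 : 0 <= t - s by rewrite subr_ge0.
rewrite (_ : _ - _ = F0 t - F0 s - f (k t) * (t - s)); last first.
  have -> : F0 (sigma T t) = F0 t + f (k t) * (sigma T t - t) by rewrite -Fs; ring.
  by ring.
apply: le_trans (_ : K' * (t - s) <= _).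
  apply: HF => // r /andP[sr rt]; apply: le_trans (ler_normB _ _) _.
  apply: le_trans (_ : K + `|f (k t)| <= _); last by rewrite /K' lerDl.
  rewrite lerD2r; apply: HK.
  have [xn xp] : - `|t| <= t /\ t <= `|t|.
    by split; [rewrite lerNl -normrN ler_norm|exact: ler_norm].
  move: std2; rewrite ltr_norml => /andP[? ?].
  by rewrite ler_norml; apply/andP; split; lra.
move: std3; rewrite ltr_pdivlMr // ger0_norm // mulrC => /ltW/le_trans; apply.
by rewrite ler_pM2l // ger0_norm; lra.
Qed.

(** * Chains of integrators *)

(** To the left of [t], [sigma T s] is caught between [s] and [t]. To the right, any point [r] of
    [T] in [(t, t + e)] bounds [sigma T s] for all [s < r]. *)
Lemma sigma_right_dense_continuous t : T t -> right_dense T t ->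
  forall e : R, 0 < e -> \forall s \near t, T s -> `|sigma T t - sigma T s| < e.
Proof.
move=> Tt ts e e0.
have [|r [Tr tr re]] := @sigma_adherent t (t + e); first by rewrite ts ltrDl.
apply/nbhs_distP; exists (r - t); rewrite ?subr_gt0 // => s str Ts.
move: str; rewrite ts ltr_norml => /andP[str1 str2].
have [st|st] := ltP s t.
  have := sigma_le Tt st; have := sigma_ge s => ? ?.
  by rewrite ger0_norm ?subr_ge0 //; lra.
have sr : s < r by lra.
have := sigma_le Tr sr; have := sigma_ge s => ? ?.
by rewrite ler0_norm ?subr_le0; lra.
Qed.

Lemma delta_antiderivative f a : continuous f ->
  exists F : R -> R, [/\ continuous F, F a = 0 &
    forall t, T t -> is_delta_derivative T F t (f t)].
Proof.
move=> cf; apply: (@antiderivative_exists f id) => // t Tt _ e e0.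
by apply/nbhs_distP; exists e.
Qed.

Lemma delta_antiderivative_sigma f a : continuous f ->
  exists F : R -> R, [/\ continuous F, F a = 0 &
    forall t, T t -> is_delta_derivative T F t (f (sigma T t))].
Proof.
move=> cf; apply: antiderivative_exists => //; first exact: sigma_nondecreasing.
exact: sigma_right_dense_continuous.
Qed.

Lemma iterated_antiderivative f a : continuous f ->
  exists h : nat -> R -> R, [/\ h 0%N = f, forall i, continuous (h i),
    forall i, h i.+1 a = 0 &
    forall i t, T t -> is_delta_derivative T (h i.+1) t (h i t)].
Proof.
move=> cf.
(* Choice needs a value for every function: the continuity hypothesis sits under the existential,
   and [id] is a dummy for discontinuous arguments. *)
have /choice[J HJ] : forall f, exists F : R -> R, continuous f ->
    [/\ continuous F, F a = 0 & forall t, T t -> is_delta_derivative T F t (f t)].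
  move=> f0; have [cf0|ncf0] := pselect (continuous f0); last by exists id.
  by have [F HF] := delta_antiderivative a cf0; exists F.
have ch i : continuous (iter i J f) by elim: i => //= i /HJ[].
exists (fun i => iter i J f); split=> // i; first by have [] := HJ _ (ch i).
by move=> t Tt; have [_ _] := HJ _ (ch i); apply.
Qed.

(* The dual chain: [g k s] is, up to the sign conventions of time scales, the
   kernel of the [k.+1]-fold antiderivative evaluated at [b]. *)
Definition costate_chain (b : R) (g : nat -> R -> R) : Prop :=
  [/\ forall t, g 0%N t = 1, forall i, continuous (g i),
    forall i, g i.+1 b = 0 &
    forall i t, T t -> is_delta_derivative T (g i.+1) t (- g i (sigma T t))].

Lemma costate_chain_exists b : exists g : nat -> R -> R, costate_chain b g.
Proof.
have /choice[J HJ] : forall f, exists F : R -> R, continuous f ->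
    [/\ continuous F, F b = 0 &
      forall t, T t -> is_delta_derivative T F t (- f (sigma T t))].
  move=> f0; have [cf0|ncf0] := pselect (continuous f0); last by exists id.
  have [|F HF] := @delta_antiderivative_sigma (fun x => - f0 x) b.
    by move=> x; apply: cvgN; exact: cf0.
  by exists F.
have cg i : continuous (iter i J (fun=> 1)).
  by elim: i => [|i /HJ[]//] x; exact: cvg_cst.
exists (fun i => iter i J (fun=> 1)); split=> // i.
  by have [] := HJ _ (cg i).
by move=> t Tt; have [_ _] := HJ _ (cg i); apply.
Qed.

(** Integration by parts along the chain: in the product rule, the term from differentiating
    [g j.+1] cancels the one from differentiating the [h] factor paired with [g j], so only the last
    survives. *)
Lemma delta_chain_duality b (g h : nat -> R -> R) k t : costate_chain b g ->
  (forall i t, T t -> is_delta_derivative T (h i.+1) t (h i t)) -> T t ->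
  is_delta_derivative T (fun s => \sum_(j < k.+1) g j s * h (k - j).+1 s) t
    (g k (sigma T t) * h 0%N t).
Proof.
move=> [g0 _ _ Hg] Hh Tt.
pose dg j := if j is i.+1 then - g i (sigma T t) else 0.
have Hdg j : is_delta_derivative T (g j) t (dg j).
  case: j => [|j]; last exact: Hg.
  by rewrite (_ : g 0%N = fun=> 1); [exact: delta_derivative_cst|exact/funext].
have tele m : (m <= k)%N ->
    \sum_(j < m.+1) (dg j * h (k - j).+1 t + g j (sigma T t) * h (k - j)%N t) =
    g m (sigma T t) * h (k - m)%N t.
  elim: m => [_|m IH mk]; first by rewrite big_ord1 /= mul0r add0r.
  rewrite big_ord_recr /= IH ?(ltnW mk) // subnSK // mulNr.
  by rewrite addrA subrr add0r.
rewrite -[in X in is_delta_derivative _ _ _ X](subnn k) -tele //.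
apply: delta_derivative_sum => j _; apply: delta_derivativeM => //; exact: Hh.
Qed.

(** Identities known only at points [sigma T r] with [r < s] thereby pass to [s] by continuity. The
    witness is the floor of a point just below [s] or, if that floor is right-dense, a later point
    of [T]. *)
Lemma sigma_left_adherent a s del : T a -> a < s -> T s -> 0 < del ->
  exists r, [/\ T r, a <= r, r < s & s - del < sigma T r <= s].
Proof.
move=> Ta as_ Ts del0.
pose x := Num.max a (s - del / 2).
have [ax sx] : a <= x /\ s - del / 2 <= x by rewrite !le_max !lexx orbT.
have xs : x < s by rewrite gt_max as_ ltrBlDr ltrDl divr_gt0.
pose r := time_scale_floor x.
have Tr : T r := time_scale_floor_in Ta ax.
have ar : a <= r := time_scale_floor_ge Ta ax.
have rx : r <= x := time_scale_floor_le x.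
have rs : r < s := le_lt_trans rx xs.
have [xsr|srx] := ltP x (sigma T r).
  exists r; split=> //; rewrite (sigma_le Ts rs) andbT.
  by apply: le_lt_trans xsr; apply: le_trans sx; rewrite lerD2l lerN2; lra.
have sr : sigma T r <= r by apply: time_scale_floor_ge srx; exact: sigma_in.
have [|p [Tp rp ps]] := @sigma_adherent r s; first exact: le_lt_trans rs.
have xp : x < p.
  by rewrite ltNge; apply/negP => /(time_scale_floor_ge Tp); rewrite leNgt rp.
exists p; split=> //; first exact: le_trans (ltW rp).
by rewrite (sigma_le Ts ps) andbT; have := sigma_ge p; lra.
Qed.

(** Induction on [d]: differentiating the relation shifts the coefficients down by one and moves the
    starting point from [a] to [sigma T a], whence the condition on the [d]-th jump. The remaining
    [q 0] is read off from [g 0 = 1]. *)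
Lemma costate_chain_free b (g : nat -> R -> R) d : costate_chain b g -> T b ->
  forall a (q : nat -> R), T a -> iter d (sigma T) a < b ->
  (forall s, T s -> a <= s -> s < b ->
     \sum_(k < d.+1) q k * g k (sigma T s) = 0) ->
  forall k, (k <= d)%N -> q k = 0.
Proof.
move=> [g0 cg _ Hg] Tb; elim: d => [|d IH] a q Ta ab H.
  move=> k; rewrite leqn0 => /eqP ->.
  by have := H a Ta (lexx a) ab; rewrite big_ord1 g0 mulr1.
pose P s := \sum_(k < d.+2) q k * g k s.
have ab' : a < b.
  apply: le_lt_trans ab; rewrite -/(iter d.+1 (sigma T) a).
  by elim: (d.+1) => //= m /le_trans; apply; exact: sigma_ge.
(* The relation gives zeros of [P] at the points [sigma T r]; continuity extends them to all of [T]
   in this range, so that [P] can be differentiated. *)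
have P0 s : T s -> sigma T a <= s -> s <= b -> P s = 0.
  move=> Ts as_ sb; move: (le_trans (sigma_ge a) as_).
  rewrite le_eqVlt => /predU1P[ea|lt_as].
    have -> : s = sigma T a by apply/le_anti; rewrite as_ -[leLHS]ea sigma_ge.
    exact: H.
  have cP : continuous P.
    apply: continuous_sumr => k _ x; apply: cvgM; first exact: cvg_cst.
    exact: cg.
  apply/eqP; rewrite -normr_eq0 eq_le normr_ge0 andbT.
  apply/ler_addgt0Pl => e e0; rewrite addr0.
  have /cvgrPdist_lt/(_ e e0)/nbhs_distP[del del0 Hdel] := cP s.
  have [r [Tr ar rs /andP[r1 r2]]] := sigma_left_adherent Ta lt_as Ts del0.
  have Pr : P (sigma T r) = 0 by apply: H => //; exact: lt_le_trans sb.
  have := Hdel (sigma T r); rewrite Pr subr0 => H'; apply/ltW/H'.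
  by rewrite ger0_norm ?subr_ge0 //; lra.
have q0 k : (k <= d)%N -> q k.+1 = 0.
  apply: (IH (sigma T a) (fun k => q k.+1)); first exact: sigma_in.
    by rewrite -iterSr.
  move=> s Ts as_ sb.
  have := @delta_derivative_eq0 P s b
    (- \sum_(k < d.+1) q k.+1 * g k (sigma T s)) Tb sb.
  move=> H'; apply/eqP; rewrite -oppr_eq0; apply/eqP/H' => //.
    by move=> r Tr sr rb; apply: P0 => //; exact: le_trans as_ sr.
  rewrite /P (_ : (fun _ => _) = fun x => q 0%N * g 0%N x +
      \sum_(k < d.+1) q k.+1 * g k.+1 x); last first.
    by apply/funext => x; rewrite big_ord_recl.
  rewrite -[X in is_delta_derivative _ _ _ X]add0r -sumrN.
  apply: delta_derivativeD.
    rewrite (_ : (fun _ => _) = fun=> q 0%N); first exact: delta_derivative_cst.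
    by apply/funext => x; rewrite g0 mulr1.
  apply: delta_derivative_sum => i _; rewrite -mulrN.
  by apply: delta_derivativeZ => //; exact: Hg.
case=> [_|k]; last by rewrite ltnS; exact: q0.
have := H a Ta (lexx a) ab'; rewrite big_ord_recl g0 mulr1 big1 ?addr0 //.
by move=> i _; rewrite q0 ?mul0r // -ltnS.
Qed.

(* Gramian argument: with controls [g j \o sigma], a kernel vector [q] of the
   endpoint matrix makes the integral of [(\sum_k q k * g k (sigma t)) ^ 2] over
   [a, b] vanish. *)
Lemma integrator_chain_reachable d a b : T a -> T b -> iter d (sigma T) a < b ->
  exists h : 'I_d.+1 -> nat -> R -> R,
    [/\ forall j i, continuous (h j i.+1),
      forall j i, h j i.+1 a = 0,
      forall j i t, T t -> is_delta_derivative T (h j i.+1) t (h j i t) &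
      \matrix_(k < d.+1, j < d.+1) h j k.+1 b \in unitmx].
Proof.
move=> Ta Tb ab; have [g cg] := costate_chain_exists b.
case: (cg) => g0 gc gb gD.
have /choice[h Hh] : forall j : 'I_d.+1, exists h : nat -> R -> R,
    [/\ h 0%N = g j \o sigma T, forall i, continuous (h i.+1),
      forall i, h i.+1 a = 0 &
      forall i t, T t -> is_delta_derivative T (h i.+1) t (h i t)].
  move=> j; have [F [cF Fa HF]] := delta_antiderivative_sigma a (gc j).
  have [h [h0 hc ha hD]] := iterated_antiderivative a cF.
  exists (fun i => if i is i'.+1 then h i' else g j \o sigma T); split=> //.
    by case=> [|i]; [rewrite h0|exact: ha].
  by case=> [|i] t Tt /=; [rewrite h0; exact: HF|exact: hD].
have h0 j t : h j 0%N t = g j (sigma T t) by case: (Hh j) => ->.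
exists h; split; [by move=> j; case: (Hh j)..|].
(* After transposition, [v] weights the controls: the combined control brings the chain back to 0 at
   [b]. *)
rewrite -unitmx_tr -row_free_unit -kermx_eq0; apply/rowV0P => v /sub_kermxP vW.
pose q i := if insub i is Some k then v 0 k else 0.
have qE (k : 'I_d.+1) : q k = v 0 k.
  by rewrite /q insubT ?ltn_ord // => ?; congr (v 0 _); exact: val_inj.
suff q0 : forall k, (k <= d)%N -> q k = 0.
  by apply/rowP => k; rewrite mxE -qE q0 // -ltnS.
pose P s := \sum_(k < d.+1) q k * g k s.
pose S k j s := \sum_(i < k.+1) g i s * h j (k - i).+1 s.
(* By duality [y] has delta derivative [P (sigma T t) ^+ 2]. It starts at 0, and its value at [b] is
   the quadratic form of the endpoint matrix at [q], again 0. Being nondecreasing, it vanishes on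
   all of [T] between, and so does the square before [b]. *)
pose y s := \sum_(k < d.+1) \sum_(j < d.+1) q k * q j * S k j s.
have yD t : T t -> is_delta_derivative T y t (P (sigma T t) ^+ 2).
  move=> Tt; rewrite expr2 [in X in is_delta_derivative _ _ _ X]/P mulr_suml.
  apply: delta_derivative_sum => k _; rewrite mulr_sumr.
  apply: delta_derivative_sum => j _.
  rewrite mulrACA; apply: delta_derivativeZ => //; rewrite -(h0 j).
  by apply: (delta_chain_duality _ cg) => // *; case: (Hh j) => _ _ _; apply.
have ya : y a = 0.
  rewrite /y big1 // => k _; rewrite big1 // => j _.
  by rewrite /S big1 ?mulr0 // => i _; case: (Hh j) => _ _ -> _; rewrite mulr0.
have Sb k j : S k j b = h j k.+1 b.
  rewrite /S big_ord_recl /= g0 mul1r subn0 big1 ?addr0 // => i _.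
  by rewrite gb mul0r.
have yb : y b = 0.
  rewrite /y big1 // => k _.
  transitivity (q k * \sum_(j < d.+1) q j * h j k.+1 b).
    by rewrite mulr_sumr; apply: eq_bigr => j _; rewrite Sb mulrA.
  rewrite -[RHS](mulr0 (q k)); congr (_ * _).
  have /rowP/(_ k) := vW; rewrite !mxE => vk; rewrite -[RHS]vk.
  by apply: eq_bigr => j _; rewrite !mxE qE.
have sq t : 0 <= P (sigma T t) ^+ 2 by exact: sqr_ge0.
have y0 s : T s -> a <= s -> s <= b -> y s = 0.
  move=> Ts as_ sb; apply/le_anti; rewrite -[X in _ <= X]yb -[X in _ && (X <= _)]ya.
  by rewrite !(@delta_derivative_nondecreasing y (fun t => P (sigma T t) ^+ 2)).
apply: (costate_chain_free cg Tb Ta ab) => s Ts as_ sb.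
apply/eqP; rewrite -(sqrf_eq0 (P (sigma T s))); apply/eqP.
apply: (delta_derivative_eq0 Tb sb _ Ts (yD s Ts)) => r Tr sr rb.
by apply: y0 => //; exact: le_trans as_ sr.
Qed.

(** * Hermite interpolation on a time scale *)

(** A Taylor polynomial at [a] fits the data there. Chains starting from 0 leave these values alone
    and correct those at [b], by invertibility of the endpoint matrix. *)
Lemma delta_hermite_interpolation d a b (al be : nat -> R) :
  T a -> T b -> iter d (sigma T) a < b ->
  exists f : nat -> R -> R, forall i, (i <= d)%N ->
    [/\ continuous (f i), f i a = al i, f i b = be i &
      forall t, T t -> is_delta_derivative T (f i) t (f i.+1 t)].
Proof.
move=> Ta Tb ab; have [h [hc ha hD hW]] := integrator_chain_reachable Ta Tb ab.
have [|e [e0 ec ea eD]] := @iterated_antiderivative (fun=> 1) a.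
  by move=> x; exact: cvg_cst.
pose tay i s := \sum_(l < d.+1 | (i <= l)%N) al l * e (l - i)%N s.
set W := (\matrix_(_, _) _) in hW.
(* Row [k] of [W] holds the [k.+1]-fold antiderivatives, which enter the derivative of order
   [d - k]; hence the reversed index. *)
pose c : 'cV_d.+1 := invmx W *m \col_k (be (d - k)%N - tay (d - k)%N b).
exists (fun i s => tay i s + \sum_j c j 0 * h j (d.+1 - i)%N s) => i id_.
split.
- move=> x; apply: cvgD.
    apply: continuous_sumr => l _ z; apply: cvgM; [exact: cvg_cst|exact: ec].
  apply: continuous_sumr => l _ z; apply: cvgM; first exact: cvg_cst.
  by rewrite subSn //; exact: hc.
- rewrite [X in _ + X]big1 ?addr0; last first.
    by move=> j _; rewrite subSn // ha mulr0.
  rewrite /tay (bigD1 (inord i)) /= inordK ?ltnS // subnn e0 mulr1.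
  rewrite big1 ?addr0 // => l /andP[il nl].
  have {}il : (i < l)%N.
    rewrite ltn_neqAle il andbT; apply: contraNneq nl => ->.
    by rewrite inord_val.
  by rewrite -[(l - i)%N]prednK ?subn_gt0 // ea mulr0.
- have Wc : W *m c = \col_k (be (d - k)%N - tay (d - k)%N b) by rewrite mulKVmx.
  have /colP/(_ (inord (d - i))) := Wc; rewrite !mxE inordK ?ltnS ?leq_subr //.
  rewrite subKn // => H; rewrite -[RHS](subrK (tay i b)) -H addrC.
  congr (_ + _); apply: eq_bigr => j _.
  by rewrite /W [X in _ = X * _]mxE inordK ?ltnS ?leq_subr // mulrC subSn.
- move=> t Tt; apply: delta_derivativeD; last first.
    apply: delta_derivative_sum => j _; apply: delta_derivativeZ => //.
    by rewrite subSn // subSS; exact: hD.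
  (* The term [l = i] is constant and differentiates to 0; the conditional puts both sums over the
     same index set. *)
  rewrite /tay [X in is_delta_derivative _ _ _ X]
    (_ : _ = \sum_(l < d.+1 | (i <= l)%N)
      if (i < l)%N then al l * e (l - i.+1)%N t else 0); last first.
    rewrite -big_mkcondr; apply: eq_bigl => l.
    by rewrite andb_idl // => /ltnW.
  apply: delta_derivative_sum => l il; case: ltnP => [lt_il|li].
    apply: delta_derivativeZ => //.
    by rewrite -subnSK //; exact: eD.
  have -> : (l - i = 0)%N by apply/eqP; rewrite subn_eq0.
  by rewrite e0; exact: delta_derivative_cst.
Qed.
End TimeScale.

(** * The Hautus test *)

(** By Cayley-Hamilton, [A ^+ n] is a combination of lower powers of [A]. *)
Lemma krylov_closed (R : fieldType) (n m : nat) (A : 'M[R]_n) (B : 'M[R]_(n, m))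
    (u : 'rV[R]_n) :
  (forall k, (k < n)%N -> u *m A ^+ k *m B = 0) -> u *m A ^+ n *m B = 0.
Proof.
case: n A B u => [|n] A B u H; first by rewrite [B]flatmx0 mulmx0.
have := Cayley_Hamilton A; rewrite /horner_mx /= /horner_morph horner_coef.
rewrite size_map_poly_id0; last first.
  by rewrite (monicP (char_poly_monic A)) oner_neq0.
rewrite size_char_poly big_ord_recr /= coef_map /=.
have -> : (char_poly A)`_n.+1 = 1.
  by have := monicP (char_poly_monic A); rewrite /lead_coef size_char_poly.
rewrite mul1r => /(congr1 (fun M => u *m M *m B)).
rewrite mulmx0 mul0mx mulmxDr mulmxDl => <-.
rewrite mulmx_sumr mulmx_suml big1 ?add0r // => k _.
by rewrite coef_map /= -mulmxE mul_scalar_mx -scalemxAr -scalemxAl H ?scaler0.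
Qed.

(** If the Kalman matrix [Ctr] has full row rank, the blocks of a right inverse serve as [K].
    Otherwise its left kernel is nonzero, stable under [A] and annihilates [B]; a complex
    eigenvector of [A] inside it contradicts the rank condition. *)
Lemma hautus_right_inverse (R : realType) (n m : nat)
    (A : 'M[R]_n) (B : 'M[R]_(n, m)) :
  (forall z : R[i], \rank (row_mx (z%:M - complexify A) (complexify B)) = n) ->
  exists K : 'I_n -> 'M[R]_(m, n), \sum_(k < n) A ^+ k *m B *m K k = 1%:M.
Proof.
move=> hrank; pose Ctr := \mxrow_(k < n) (A ^+ k *m B).
have [fCtr|nfree] := boolP (row_free Ctr).
  exists (fun k => submxcol (pinvmx Ctr) k).
  by rewrite -(mulmxVp fCtr) -{2}[pinvmx Ctr]submxcolK mul_mxrow_mxcol.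
have kerE r (u : 'M_(r, n)) :
    (u <= kermx Ctr)%MS <-> forall k : 'I_n, u *m (A ^+ k *m B) = 0.
  split=> [/sub_kermxP|H].
    by rewrite /Ctr mul_mxrow -(mxrow0 _) => /eq_mxrowP.
  by apply/sub_kermxP; rewrite /Ctr mul_mxrow -(mxrow0 _); apply/eq_mxrowP.
have r0 : (0 < \rank (kermx Ctr))%N by rewrite lt0n mxrank_eq0 kermx_eq0.
have n0 : (0 < n)%N by apply: leq_trans r0 (rank_leq_row _).
set r := \rank (kermx Ctr) in r0; pose K : 'M_(r, n) := row_base (kermx Ctr).
have Kker : (K <= kermx Ctr)%MS by rewrite eq_row_base.
have fK : row_free K by exact: row_base_free.
have KA : (K *m A <= K)%MS.
  rewrite eq_row_base; apply/row_subP => i; apply/kerE => k.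
  have Ki j : (j < n)%N -> row i K *m A ^+ j *m B = 0.
    move=> jn; rewrite -mulmxA; apply: ((kerE _ _).1 _ (Ordinal jn)).
    by apply: submx_trans Kker; exact: row_sub.
  rewrite row_mul -mulmxA (mulmxA A) -[A *m A ^+ k]/(A * A ^+ k) -exprS mulmxA.
  have [kn|kn] := ltnP k.+1 n; first exact: Ki.
  have -> : k.+1 = n by apply/anti_leq; rewrite kn ltn_ord.
  exact: krylov_closed.
have KB : K *m B = 0.
  by have := (kerE _ _).1 Kker (Ordinal n0); rewrite expr0 mul1mx.
(* [K *m A *m pinvmx K] is the action of [A] on the kernel in the basis [K], so [w *m complexify K]
   is a left eigenvector of [A]. *)
have [z /eigenvalueP[w wM w0]] :=
  eigenvalue_closed (complexify (K *m A *m pinvmx K)) r0.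
have /negP[] := w0.
have fz : row_free (row_mx (z%:M - complexify A) (complexify B)).
  by rewrite /row_free hrank.
have fcK : row_free (complexify K) by rewrite /complexify row_free_map.
rewrite -(mulmx_free_eq0 w fcK) -(mulmx_free_eq0 (w *m complexify K) fz).
rewrite mul_mx_row mulmxBr mul_mx_scalar -mulmxA -map_mxM -mulmxA -map_mxM KB.
rewrite map_mx0 mulmx0 -{1}(mulmxKpV KA) map_mxM mulmxA wM -scalemxAl subrr.
by rewrite row_mx0.
Qed.

(** [K] stacks the real and imaginary parts of a complex left eigenvector that annihilates [B], and
    [M] is the real matrix of multiplication by [z]. *)
Lemma uncontrollable_mode_real (R : realType) (n m : nat)
    (A : 'M[R]_n) (B : 'M[R]_(n, m)) (z : R[i]) :
  \rank (row_mx (z%:M - complexify A) (complexify B)) <> n ->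
  exists (K : 'M[R]_(1 + 1, n)) (M : 'M[R]_(1 + 1)),
    [/\ K != 0, K *m A = M *m K & K *m B = 0].
Proof.
move=> /eqP; rewrite -[_ == n]/(row_free _) => nfree.
have {nfree}[v v0 vz] : exists2 v : 'rV[R[i]]_n, v != 0 &
    v *m row_mx (z%:M - complexify A) (complexify B) = 0.
  move: nfree; rewrite -kermx_eq0 => /rowV0Pn[v /sub_kermxP vK v0].
  by exists v.
move: vz; rewrite mul_mx_row -row_mx0 => /eq_row_mx[].
rewrite mulmxBr mul_mx_scalar => /eqP; rewrite subr_eq0 => /eqP/esym vA vB.
have ReD : {morph (@complex.Re R) : x y / x + y} by case=> ? ? [].
have ImD : {morph (@complex.Im R) : x y / x + y} by case=> ? ? [].
have ReMC (x y : R[i]) : complex.Re (x * y) =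
    complex.Re x * complex.Re y - complex.Im x * complex.Im y.
  by case: x => ? ?; case: y.
have ImMC (x y : R[i]) : complex.Im (x * y) =
    complex.Re x * complex.Im y + complex.Im x * complex.Re y.
  by case: x => ? ?; case: y.
have ReE p (D : 'M[R]_(n, p)) :
    map_mx (@complex.Re R) (v *m complexify D) = map_mx (@complex.Re R) v *m D.
  apply/rowP => j; rewrite !mxE (big_morph _ ReD (erefl _)).
  by apply: eq_bigr => i _; rewrite !mxE ReMC /= mulr0 subr0.
have ImE p (D : 'M[R]_(n, p)) :
    map_mx (@complex.Im R) (v *m complexify D) = map_mx (@complex.Im R) v *m D.
  apply/rowP => j; rewrite !mxE (big_morph _ ImD (erefl _)).
  by apply: eq_bigr => i _; rewrite !mxE ImMC /= mulr0 add0r.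
set a := map_mx _ v in ReE; set b := map_mx _ v in ImE.
exists (col_mx a b), (block_mx (complex.Re z)%:M (- complex.Im z)%:M
                               (complex.Im z)%:M (complex.Re z)%:M).
split.
- apply: contraNneq v0 => K0.
  have [a0 b0] : a = 0 /\ b = 0 by apply: eq_col_mx; rewrite K0 col_mx0.
  apply/eqP/rowP => j; rewrite mxE; apply/eqP; rewrite eq_complex.
  move/rowP/(_ j): a0; move/rowP/(_ j): b0; rewrite !mxE => -> ->.
  by rewrite !eqxx.
- rewrite mul_col_mx mul_block_col -ReE -ImE vA !mul_scalar_mx; congr col_mx.
    by apply/rowP => j; rewrite !mxE ReMC mulNr.
  by apply/rowP => j; rewrite !mxE ImMC addrC.
- rewrite mul_col_mx -ReE -ImE vB -[RHS]col_mx0.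
  by congr col_mx; apply/rowP => j; rewrite !mxE.
Qed.

(** * Controllability *)

Lemma delta_derivativevD (R : realType) (T : set R) (n : nat)
    (x y : R -> 'cV[R]_n) (t : R) (d1 d2 : 'cV[R]_n) :
  is_delta_derivativev T x t d1 -> is_delta_derivativev T y t d2 ->
  is_delta_derivativev T (fun s => x s + y s) t (d1 + d2).
Proof.
move=> Hx Hy i; rewrite mxE (_ : (fun _ => _) = fun s => x s i 0 + y s i 0).
  exact: delta_derivativeD.
by apply/funext => s; rewrite mxE.
Qed.

Lemma delta_derivativev_sum (R : realType) (T : set R) (n : nat) (I : Type)
    (r : seq I) (P : pred I) (F : I -> R -> 'cV[R]_n) (D : I -> 'cV[R]_n) (t : R) :
  (forall i, P i -> is_delta_derivativev T (F i) t (D i)) ->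
  is_delta_derivativev T (fun s => \sum_(i <- r | P i) F i s) t
    (\sum_(i <- r | P i) D i).
Proof.
move=> H i; rewrite summxE.
rewrite (_ : (fun _ => _) = fun s => \sum_(j <- r | P j) F j s i 0).
  by apply: delta_derivative_sum => j Pj; exact: H.
by apply/funext => s; rewrite summxE.
Qed.

Lemma delta_derivativev_mulmx (R : realType) (T : set R) (n p : nat)
    (K : 'M[R]_(p, n)) (x : R -> 'cV[R]_n) (t : R) (d : 'cV[R]_n) :
  closed T -> ~ has_ubound T -> T t ->
  is_delta_derivativev T x t d ->
  is_delta_derivativev T (fun s => K *m x s) t (K *m d).
Proof.
move=> hT hunb Tt Hx i; rewrite mxE.
rewrite (_ : (fun _ => _) = fun s => \sum_j K i j * x s j 0).
  by apply: delta_derivative_sum => j _; apply: delta_derivativeZ => //; exact: Hx.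
by apply/funext => s; rewrite mxE.
Qed.

Lemma continuous_rd_continuous (R : realType) (T : set R) (f : R -> R) :
  continuous f -> rd_continuous T f.
Proof.
move=> cf; split=> t Tt _; first by apply: cvg_within_filter; exact: cf.
by exists (f t); apply: cvg_within_filter; exact: cf.
Qed.

Lemma continuous_mulmx_entry (R : realType) (n p : nat) (K : 'M[R]_(p, n))
    (x : R -> 'cV[R]_n) :
  (forall i, continuous (fun t => x t i 0)) ->
  forall i, continuous (fun t => (K *m x t) i 0).
Proof.
move=> cx i; rewrite (_ : (fun _ => _) = fun s => \sum_j K i j * x s j 0).
  apply: continuous_sumr => j _ t; apply: cvgM; first exact: cvg_cst.
  exact: cx.
by apply/funext => s; rewrite mxE.
Qed.

Lemma controllable_hautus (R : realType) (T : set R) (t0 : R) (n m p : nat)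
    (A : 'M[R]_n) (B : 'M[R]_(n, m)) (C : 'M[R]_(p, n)) :
  closed T -> ~ has_ubound T -> T t0 -> controllable T A B C t0 ->
  forall z : R[i],
    \rank (row_mx (z%:M - complexify A) (complexify B)) = n.
Proof.
move=> hT hunb Tt0 [tf [Ttf t0f ctrl]] z; apply: contrapT.
move=> /uncontrollable_mode_real[K [M [K0 KA KB]]].
move/eqP: K0; apply; apply/matrixP => i j; rewrite mxE.
(* Steering 0 to the [j]-th basis vector turns [K *m x tf] into column [j] of [K]. *)
have [u [_ [x [y [[xt0 xD _] xtf]]]]] := ctrl 0 (delta_mx j 0).
suff : K *m x tf = 0.
  by rewrite xtf -colE => /colP/(_ i); rewrite !mxE.
apply: (linear_delta_unique hT hunb (M := M) (w := fun t => K *m x t) Tt0 Ttf).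
- exact: ltW.
- move=> t Tt; rewrite mulmxA -KA -mulmxA.
  (* The zero term [K *m B *m u t] is inserted to recover [K] applied to the state equation. *)
  rewrite -[X in is_delta_derivativev _ _ _ X]addr0 -(mul0mx _ (u t)) -KB.
  rewrite -mulmxA -mulmxDr; apply: delta_derivativev_mulmx => //; exact: xD.
- by rewrite xt0 mulmx0.
Qed.

(* With [C = B *m K k], both sides of the telescoping identity are
   [\sum_(j <= k) A ^+ (k - j) *m C *m g j] minus its term [j = 0]. *)
Lemma flat_parametrization (R : pzRingType) (n m : nat)
    (A : 'M[R]_n) (B : 'M[R]_(n, m)) (K : 'I_n -> 'M[R]_(m, n))
    (xi0 xi1 : 'cV[R]_n) (g : nat -> 'cV[R]_n) :
  \sum_(k < n) A ^+ k *m B *m K k = 1%:M -> g 0%N = xi1 - A *m xi0 ->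
  A *m (xi0 + \sum_(k < n) \sum_(j < k) A ^+ (k - j.+1) *m (B *m K k) *m g j) +
    B *m (\sum_(k < n) K k *m g k) =
  xi1 + \sum_(k < n) \sum_(j < k) A ^+ (k - j.+1) *m (B *m K k) *m g j.+1.
Proof.
move=> K1 g0.
have tele (k : nat) (C : 'M[R]_n) :
    \sum_(j < k) A ^+ (k - j.+1) *m C *m g j.+1 =
    A *m (\sum_(j < k) A ^+ (k - j.+1) *m C *m g j) + C *m g k -
      A ^+ k *m C *m g 0%N.
  have : \sum_(j < k.+1) A ^+ (k - j) *m C *m g j =
      A *m (\sum_(j < k) A ^+ (k - j.+1) *m C *m g j) + C *m g k.
    rewrite big_ord_recr /= subnn expr0 mul1mx mulmx_sumr; congr (_ + _).
    apply: eq_bigr => j _; rewrite !mulmxA.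
    by rewrite -[A *m A ^+ _]/(A * A ^+ _) -exprS subnSK.
  by rewrite big_ord_recl subn0 /= => <-; rewrite addrC addKr.
have -> : \sum_(k < n) \sum_(j < k) A ^+ (k - j.+1) *m (B *m K k) *m g j.+1 =
    A *m (\sum_(k < n) \sum_(j < k) A ^+ (k - j.+1) *m (B *m K k) *m g j) +
    B *m (\sum_(k < n) K k *m g k) - g 0%N.
  (* Summed over [k], the leftover terms [A ^+ k *m B *m K k *m g 0] add up to [g 0] by [K1]. *)
  rewrite -[g 0%N]mul1mx -K1 !mulmx_sumr mulmx_suml -big_split -sumrB /=.
  by apply: eq_bigr => k _; rewrite tele !mulmxA.
by rewrite g0 mulmxDr opprB [RHS]addrC -[RHS]addrA subrK [RHS]addrC addrA.
Qed.

Lemma hautus_controllable (R : realType) (T : set R) (t0 : R) (n m p : nat)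
    (A : 'M[R]_n) (B : 'M[R]_(n, m)) (C : 'M[R]_(p, n)) :
  closed T -> ~ has_ubound T -> T t0 ->
  (forall z : R[i],
    \rank (row_mx (z%:M - complexify A) (complexify B)) = n) ->
  controllable T A B C t0.
Proof.
move=> hT hunb Tt0 /hautus_right_inverse[K K1].
(* Interpolating derivatives up to order [n] requires [tf] to lie beyond the [n]-th jump of [t0]. *)
have [tf Ttf tfn] := time_scale_above hunb (iter n (sigma T) t0).
exists tf; split=> //.
  apply: le_lt_trans tfn; elim: n {A B C K K1} => //= k /le_trans; apply.
  exact: sigma_ge.
move=> x0 xf.
(* The endpoint derivatives are those of the free motion, [A ^+ j *m x0] and [A ^+ j *m xf]. They
   make [g j] vanish at both ends for [j < n], so that [x] agrees with [xi] there. *)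
have /choice[f Hf] : forall i : 'I_n, exists f : nat -> R -> R,
    forall j, (j <= n)%N ->
    [/\ continuous (f j), f j t0 = (A ^+ j *m x0) i 0,
      f j tf = (A ^+ j *m xf) i 0 &
      forall t, T t -> is_delta_derivative T (f j) t (f j.+1 t)].
  by move=> i; exact: (delta_hermite_interpolation hT hunb _ _ Tt0 Ttf tfn).
pose xi j t : 'cV[R]_n := \col_i f i j t.
pose g j t := xi j.+1 t - A *m xi j t.
have xiD j t : (j <= n)%N -> T t -> is_delta_derivativev T (xi j) t (xi j.+1 t).
  move=> jn Tt i; rewrite mxE (_ : (fun _ => _) = f i j).
    by have [_ _ _] := Hf i j jn; apply.
  by apply/funext => s; rewrite mxE.
have gD j t : (j < n)%N -> T t -> is_delta_derivativev T (g j) t (g j.+1 t).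
  move=> jn Tt; rewrite /g -!mulNmx; apply: delta_derivativevD; first exact: xiD.
  rewrite (_ : (fun _ => _) = fun s => - A *m xi j s); last first.
    by apply/funext => s; rewrite mulNmx.
  by apply: delta_derivativev_mulmx => //; apply: xiD => //; exact: ltnW.
have xi_t0 j : (j <= n)%N -> xi j t0 = A ^+ j *m x0.
  by move=> jn; apply/colP => i; rewrite mxE; have [_ -> _ _] := Hf i j jn.
have xi_tf j : (j <= n)%N -> xi j tf = A ^+ j *m xf.
  by move=> jn; apply/colP => i; rewrite mxE; have [_ _ -> _] := Hf i j jn.
have g_t0 j : (j < n)%N -> g j t0 = 0.
  by move=> jn; rewrite /g !xi_t0 ?(ltnW jn) // mulmxA exprS subrr.
have g_tf j : (j < n)%N -> g j tf = 0.
  by move=> jn; rewrite /g !xi_tf ?(ltnW jn) // mulmxA exprS subrr.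
pose x t := xi 0%N t +
  \sum_(k < n) \sum_(j < k) A ^+ (k - j.+1) *m (B *m K k) *m g j t.
pose u t := \sum_(k < n) K k *m g k t.
have x_end t : (forall j, (j < n)%N -> g j t = 0) -> x t = xi 0%N t.
  move=> g0; rewrite /x big1 ?addr0 // => k _; rewrite big1 // => j _.
  by rewrite g0 ?mulmx0 // (ltn_trans _ (ltn_ord k)).
exists u; split.
  move=> i; apply: continuous_rd_continuous.
  rewrite (_ : (fun _ => _) = fun s => \sum_k (K k *m g k s) i 0); last first.
    by apply/funext => s; rewrite summxE.
  apply: continuous_sumr => k _; apply: continuous_mulmx_entry => {}i.
  have cxi j l : (j <= n)%N -> continuous (fun t => xi j t l 0).
    move=> jn; rewrite (_ : (fun _ => _) = f l j); first by case: (Hf l j jn).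
    by apply/funext => s; rewrite mxE.
  rewrite (_ : (fun _ => _) = fun s => xi k.+1 s i 0 - (A *m xi k s) i 0); last first.
    by apply/funext => s; rewrite !mxE.
  move=> s; apply: cvgB; first exact: cxi.
  by apply: continuous_mulmx_entry => l; apply: cxi; exact: ltnW.
exists x, (fun t => C *m x t); split; last first.
  by rewrite x_end // xi_tf // expr0 mul1mx.
split=> //; first by rewrite x_end // xi_t0 // expr0 mul1mx.
move=> t Tt; have -> := flat_parametrization (xi0 := xi 0%N t) (xi1 := xi 1%N t)
  (g := fun j => g j t) K1 erefl.
apply: delta_derivativevD; first exact: xiD.
apply: delta_derivativev_sum => k _; apply: delta_derivativev_sum => j _.
apply: delta_derivativev_mulmx => //; apply: gD => //.
exact: ltn_trans (ltn_ord k).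
Qed.

Theorem theorem2p11 (R : realType) (T : set R) (hT : time_scale T)
    (hunb : ~ has_ubound T) (hmu : bounded_graininess T)
    (t0 : R) (ht0 : T t0) (n m p : nat) (hpn : (p <= n)%N) (hmn : (m <= n)%N)
    (A : 'M[R]_n) (B : 'M[R]_(n, m)) (C : 'M[R]_(p, n))
    (hA : regressive T A) :
  controllable T A B C t0 <->
  forall z : R[i],
    \rank (row_mx (z%:M - complexify A) (complexify B)) = n.
Proof.
have [_ cT] := hT; split; first exact: controllable_hautus.
exact: hautus_controllable.
Qed.
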